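(* For every integer $k\ge 1$, $\rho'(H_k)\ge \lceil 3^{k-1}/2\rceil$.
   Context: All tournaments are finite. A tournament is a complete oriented graph: a digraph $T$ with vertex set $V(T)$ and arc set $A(T)$ (no loops) such that for all distinct $u,v\in V(T)$ exactly one of $uv$, $vu$ belongs to $A(T)$. $Aut(T)$ denotes the automorphism group of $T$; the identity is the trivial automorphism. The tournaments $H_k$ ($k\ge 0$) are defined inductively. $H_0$ is the tournament with a single vertex. For $k>0$, $H_k$ is obtained from three vertex-disjoint copies $T_1,T_2,T_3$ of $H_{k-1}$ (called the tertians of $H_k$) by adding all arcs from vertices of $T_1$ to vertices of $T_2$, all arcs from vertices of $T_2$ to vertices of $T_3$, and all arcs from vertices of $T_3$ to vertices of $T_1$. Thus $|V(H_k)|=3^k$. An arc labeling of $T$ with two labels is a total function $\phi:A(T)\to L$ with $|L|=2$ (not required to be surjective, so a label class may be empty). An automorphism $\sigma\in Aut(T)$ preserves $\phi$ if $\phi(uv)=\phi(\sigma(u)\sigma(v))$ for every arc $uv\in A(T)$. The labeling $\phi$ is 2-distinguishing if no nontrivial automorphism preserves it. A distinguishing arc class is one of the two sets of arcs having the same label under a 2-distinguishing arc labeling. $\rho'(T)$ denotes the minimum size of a distinguishing arc class of $T$, over all 2-distinguishing arc labelings of $T$. (Every finite tournament has a 2-distinguishing arc labeling, so $\rho'(T)$ is defined.) *)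

(* Defs.v *)
From mathcomp Require Import all_boot all_fingroup.

Set Implicit Arguments.
Unset Strict Implicit.
Unset Printing Implicit Defensive.

Record tournament := Tournament {
  vertex :> finType;
  arc : rel vertex;
  arc_irr : irreflexive arc;
  (* (+) is exclusive or *)
  arc_xor : forall u v, u != v -> arc u v (+) arc v u
}.

Notation arcs T := {a : vertex T * vertex T | arc a.1 a.2}.

(* Products in {perm T}, hence in this group, are read from left to right. *)
Definition automorphisms (T : tournament) : {set {perm T}} :=
  [set s : {perm T} | [forall u, forall v, arc (s u) (s v) == arc u v]].

Lemma automorphisms_group_set (T : tournament) : group_set (automorphisms T).
Proof.
apply/group_setP; split=> [|s t].
  by rewrite inE; apply/'forall_forallP => u v; rewrite !perm1.
rewrite !inE => /'forall_'forall_eqP hs /'forall_'forall_eqP ht.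
by apply/'forall_'forall_eqP => u v; rewrite !permM ht hs.
Qed.

Canonical automorphisms_group (T : tournament) :=
  Group (automorphisms_group_set T).

Section Labelings.
Variable T : tournament.

(* The two-element label set is bool; labelings need not be surjective. *)
Definition labeling := {ffun arcs T -> bool}.

(* When s is an automorphism, every arc a has exactly one image arc b. *)
Definition preserves (s : {perm T}) (phi : labeling) : bool :=
  [forall a : arcs T, forall b : arcs T,
     (val b == (s (val a).1, s (val a).2)) ==> (phi a == phi b)].

Definition distinguishing (phi : labeling) : bool :=
  [forall s in automorphisms T, preserves s phi ==> (s == 1%g)].

Definition distinguishing_class (C : {set arcs T}) : bool :=
  [exists phi : labeling, exists l : bool,
     distinguishing phi && (C == [set a | phi a == l])].

(* Label by true exactly the arcs of a Hamiltonian path: an automorphism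
   preserving this labeling fixes the path, hence every vertex. *)
Lemma distinguishing_ex : exists phi, distinguishing phi.
Proof.
pose le := [rel u v : T | (u == v) || arc u v].
have le_total : total le.
  move=> u v /=; have [-> | neq_uv] := eqVneq u v; first by [].
  by have := arc_xor neq_uv; case: (arc u v) => //= ->; rewrite orbT.
pose s := sort le (enum T).
have mem_s u : u \in s by rewrite mem_sort mem_enum.
have uniq_s : uniq s by rewrite sort_uniq enum_uniq.
have sorted_s : sorted le s by apply: sort_sorted.
pose idx u := index u s.
exists [ffun a : arcs T => idx (val a).2 == (idx (val a).1).+1].
apply/forall_inP => g; rewrite inE => /'forall_'forall_eqP g_aut.
apply/implyP => /forallP g_pres.
case def_s: (size s) => [|n].
  by apply/eqP/permP => u; have := mem_s u; rewrite (size0nil def_s).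
have x0 : T by case: s def_s {mem_s uniq_s sorted_s idx g_pres} => [|x0].
have nth_arc i : i.+1 < size s -> arc (nth x0 s i) (nth x0 s i.+1).
  move=> lt_i; have /= := (sortedP x0 sorted_s) i lt_i.
  by rewrite nth_uniq ?(ltnW lt_i) // -[i == _]negbK neq_ltn ltnSn.
have step i : i.+1 < size s ->
    idx (g (nth x0 s i.+1)) = (idx (g (nth x0 s i))).+1.
  move=> lt_i; have Aa := nth_arc i lt_i.
  have Ab : arc (g (nth x0 s i)) (g (nth x0 s i.+1)) by rewrite g_aut.
  pose a : arcs T := exist (fun a => arc a.1 a.2) (_, _) Aa.
  pose b : arcs T := exist (fun a => arc a.1 a.2) (_, _) Ab.
  have /forallP/(_ b) := g_pres a; rewrite eqxx /= !ffunE /=.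
  by rewrite /idx !index_uniq ?(ltnW lt_i) // eqxx => /eqP/esym/eqP.
have idxE i : i < size s -> idx (g (nth x0 s i)) = idx (g (nth x0 s 0)) + i.
  elim: i => [|i IHi] lt_i; first by rewrite addn0.
  by rewrite step // IHi ?(ltnW lt_i) // addnS.
have idx0 : idx (g (nth x0 s 0)) = 0.
  have := idxE n; rewrite def_s ltnSn => /(_ isT) idx_n.
  have : idx (g (nth x0 s n)) < size s by rewrite index_mem.
  by rewrite idx_n def_s ltnS -{2}[n]add0n leq_add2r leqn0 => /eqP.
apply/eqP/permP => u; rewrite perm1.
have lt_u : idx u < size s by rewrite index_mem.
have := idxE _ lt_u; rewrite idx0 add0n /idx nth_index // => eq_idx.
by rewrite -[LHS](nth_index x0 (mem_s _)) eq_idx nth_index.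
Qed.

Lemma distinguishing_class_size_ex :
  exists n, [exists C : {set arcs T}, distinguishing_class C && (#|C| == n)].
Proof.
have [phi phi_dist] := distinguishing_ex.
exists #|[set a | phi a == true]|; apply/existsP.
exists [set a | phi a == true]; rewrite eqxx andbT.
by apply/existsP; exists phi; apply/existsP; exists true; rewrite phi_dist eqxx.
Qed.

Definition rho' : nat := ex_minn distinguishing_class_size_ex.

End Labelings.

Section CyclicTriple.
Variable T : tournament.

(* (i, u) is the vertex u of the i-th copy of T, and
   ordS : 'I_3 -> 'I_3 is the cyclic successor 0 -> 1 -> 2 -> 0. *)
Definition triple_arc : rel ('I_3 * T) :=
  fun x y => if x.1 == y.1 then arc x.2 y.2 else y.1 == ordS x.1.

Lemma triple_arc_irr : irreflexive triple_arc.
Proof. by move=> x; rewrite /triple_arc eqxx arc_irr. Qed.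

Lemma triple_arc_xor x y : x != y -> triple_arc x y (+) triple_arc y x.
Proof.
case: x y => [i u] [j v]; rewrite /triple_arc /= [j == i]eq_sym.
have [<- | neq_ij _] := eqVneq i j.
  by rewrite xpair_eqE eqxx /=; apply: arc_xor.
by move: i j neq_ij => [[|[|[|?]]] ?] [[|[|[|?]]] ?].
Qed.

Definition triple : tournament := Tournament triple_arc_irr triple_arc_xor.

End CyclicTriple.

Lemma unit_arc_xor (u v : unit) : u != v -> false (+) false.
Proof. by case: u v => [] []. Qed.

Definition single : tournament :=
  @Tournament unit (fun _ _ => false) (fun _ => erefl) unit_arc_xor.

Fixpoint H (k : nat) : tournament :=
  if k is k'.+1 then triple (H k') else single.

Lemma card_H k : #|H k| = 3 ^ k.
Proof.
elim: k => [|k IHk]; first exact: card_unit.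
by rewrite [LHS]card_prod card_ord IHk -expnS.
Qed.

(* Main.v *)
Require Import Defs.
From mathcomp Require Import all_boot all_fingroup.

Set Implicit Arguments.
Unset Strict Implicit.
Unset Printing Implicit Defensive.

(** The vertices of [H k.+1] split into [3 ^ k] blocks, the copies of the
cyclic triangle from which the construction starts.  All vertices of a block
are related in the same way to any vertex outside it, so rotating one block
and fixing all other vertices is a nontrivial automorphism.

If no arc of a label class [C] touches some block, the rotation of that block
fixes each arc of [C] and permutes the arcs outside [C], so it preserves the
labeling.  A distinguishing class therefore touches every block
([distinguishing_class_touches]).  An arc has two endpoints and hence touches
at most two blocks, so there are at most twice as many blocks as arcs in the
class ([distinguishing_class_card]).

The blocks are described by a map [f : T -> B] whose fibres they are.  Only two
properties of [f] matter: the number of fibres, and the existence of a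
nontrivial automorphism supported in each fibre.  For [H k.+1] the set of
blocks is [H k] itself, since contracting every block gives [H k]. *)

(** A family of nontrivial automorphisms with pairwise disjoint supports, indexed
by [B]; a map [f] encodes the disjointness, since its fibres are disjoint. *)
Definition fibrewise_movable (T : tournament) (B : Type) (f : T -> B) : Prop :=
  forall b, exists s : {perm T},
    [/\ s \in automorphisms T, s != 1%g & forall u, s u != u -> f u = b].

(** An automorphism that is the identity on the endpoints of a label class
fixes that class arc by arc; as there are only two labels, the remaining arcs
all carry the other one, and the labeling is preserved. *)
Lemma preserves_fix_class (T : tournament) (phi : labeling T) (l : bool)
    (s : {perm T}) :
    (forall a : arcs T, phi a = l ->
       s (val a).1 = (val a).1 /\ s (val a).2 = (val a).2) ->
  preserves s phi.
Proof.
move=> fix_l; apply/forallP=> a; apply/forallP=> b; apply/implyP=> /eqP def_b.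
have same_label : s (val a).1 = (val a).1 /\ s (val a).2 = (val a).2 ->
    phi a == phi b.
  case=> fix1 fix2; have -> // : b = a.
  by apply: val_inj; rewrite def_b fix1 fix2; case: (val a).
have [/fix_l/same_label // | a'l] := eqVneq (phi a) l.
have [bl | b'l] := eqVneq (phi b) l; last first.
  by move: a'l b'l; case: (phi a) (phi b) l {fix_l same_label} => -[] [].
(* Here the image arc is in the class, so it is fixed, and injectivity of [s]
   carries this back to [a]. *)
apply: same_label; have := fix_l b bl; rewrite def_b.
by case=> /perm_inj fix1 /perm_inj fix2.
Qed.

Lemma distinguishing_class_touches (T : tournament) (B : eqType) (f : T -> B)
    (C : {set arcs T}) (b : B) :
    fibrewise_movable f -> distinguishing_class C ->
  exists2 a, a \in C & (f (val a).1 == b) || (f (val a).2 == b).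
Proof.
move=> /(_ b)[s [s_aut s_neq1 s_supp]] /existsP[phi /existsP[l]].
case/andP=> /forall_inP/(_ s s_aut)/implyP phi_dist /eqP->.
apply/exists_inP; apply: contraT; rewrite negb_exists_in => /forall_inP untouched.
rewrite -(negbTE s_neq1); apply/phi_dist/(@preserves_fix_class _ _ l)=> a al.
have := untouched a; rewrite inE al eqxx negb_or => /(_ isT)/andP[f1 f2].
by split; apply/eqP; [apply: contraNT f1 | apply: contraNT f2];
  move=> /s_supp->.
Qed.

Lemma distinguishing_class_card (T : tournament) (B : finType) (f : T -> B)
    (C : {set arcs T}) :
  fibrewise_movable f -> distinguishing_class C -> #|B| <= #|C|.*2.
Proof.
move=> f_mov C_dist.
pose f1 (a : arcs T) := f (val a).1; pose f2 (a : arcs T) := f (val a).2.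
have cover_B : [set: B] \subset f1 @: C :|: f2 @: C.
  apply/subsetP=> b _; rewrite inE.
  have [a Ca] := distinguishing_class_touches b f_mov C_dist.
  by case/orP=> /eqP <-; rewrite ?(imset_f f1 Ca) ?(imset_f f2 Ca) ?orbT.
rewrite -cardsT (leq_trans (subset_leq_card cover_B)) //.
rewrite (leq_trans (leq_card_setU _ _)) // -addnn.
by rewrite leq_add // leq_imset_card.
Qed.

Section Copies.
Variable T : tournament.

Definition on_copy (i : 'I_3) (s : {perm T}) (x : triple T) : triple T :=
  (x.1, if x.1 == i then s x.2 else x.2).

Lemma on_copy_inj i s : injective (on_copy i s).
Proof.
move=> [j u] [j' v] [<-] /=; case: ifP => _; last by move->.
by move=> /perm_inj->.
Qed.

Definition copy_perm i s : {perm triple T} := perm (@on_copy_inj i s).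

(** Adjacency between different copies depends on the copies alone, so an
automorphism may act on one copy independently of the others. *)
Lemma copy_perm_aut i s :
  s \in automorphisms T -> copy_perm i s \in automorphisms (triple T).
Proof.
rewrite !inE => /'forall_'forall_eqP s_aut.
apply/'forall_'forall_eqP => x y; rewrite !permE /= /triple_arc /=.
by case: eqP => // <-; case: eqP => // _; rewrite s_aut.
Qed.

Lemma fibrewise_movable_triple (B : eqType) (f : T -> B) :
  fibrewise_movable f ->
  fibrewise_movable (fun x : triple T => (x.1, f x.2)).
Proof.
move=> f_mov [i b]; have [s [s_aut s_neq1 s_supp]] := f_mov b.
exists (copy_perm i s); split; first exact: copy_perm_aut.
  apply: contraNneq s_neq1 => copy1; apply/eqP/permP=> u.
  have /(congr1 snd) := congr1 (fun t : {perm _} => t (i, u)) copy1.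
  by rewrite !permE /= eqxx.
move=> [j u]; rewrite permE /on_copy /= xpair_eqE eqxx /=.
by case: (eqVneq j i) => [-> /s_supp-> | _]; rewrite ?eqxx.
Qed.

Definition rotate (x : triple T) : triple T := (ordS x.1, x.2).

Lemma rotate_inj : injective rotate.
Proof.
move=> [i u] [j v] eq_r; have /= -> := congr1 snd eq_r.
by have /= /ordS_inj-> := congr1 fst eq_r.
Qed.

Definition rotate_perm : {perm triple T} := perm rotate_inj.

Lemma rotate_perm_aut : rotate_perm \in automorphisms (triple T).
Proof.
rewrite inE; apply/'forall_'forall_eqP => x y; rewrite !permE /= /triple_arc /=.
by rewrite !(inj_eq (@ordS_inj 3)).
Qed.

Lemma rotate_perm_neq1 (u : T) : rotate_perm != 1%g.
Proof.
apply/eqP=> /(congr1 (fun t : {perm _} => t (ord0, u))).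
by rewrite !permE => -[].
Qed.

End Copies.

(** The block map is the contraction of the innermost triangles: it drops the
last of the [k.+1] coordinates of a vertex of [H k.+1]. *)
Lemma H_fibrewise_movable k : exists f : H k.+1 -> H k, fibrewise_movable f.
Proof.
elim: k => [|k [f f_mov]].
  exists (fun=> tt) => -[]; exists (rotate_perm single).
  by split=> //; [exact: rotate_perm_aut | exact: (@rotate_perm_neq1 single tt)].
by exists (fun x : H k.+2 => (x.1, f x.2)); apply: fibrewise_movable_triple.
Qed.

(* uphalf n is n / 2 rounded up. *)
Theorem proposition3 (k : nat) (hk : 1 <= k) :
  uphalf (3 ^ (k - 1)) <= rho' (H k).
Proof.
case: k hk => // k _; rewrite subn1 /= -card_H leq_uphalf_double.
rewrite /rho'; case: ex_minnP => n /existsP[C /andP[C_dist /eqP <-]] _.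
have [f f_mov] := H_fibrewise_movable k.
exact: distinguishing_class_card f_mov C_dist.
Qed.
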